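(* Let $h\geqslant 0$ be an integer and let $G$ be a super-$\lambda^{(h)}$ graph. Then $\rho^{(h)}(G)\leqslant \delta(G)-1$, where $\delta(G)$ is the minimum vertex-degree of $G$.
   Context: All graphs are finite and simple. For a connected graph $G=(V,E)$ and an integer $h\geqslant 0$, a set $F\subseteq E(G)$ is an $h$-extra edge-cut if $G-F$ is disconnected and every component of $G-F$ has more than $h$ vertices. If such a set exists, $\lambda^{(h)}(G)$ is the minimum cardinality of an $h$-extra edge-cut, and $G$ is called a $\lambda^{(h)}$-graph (or $\lambda^{(h)}$-connected); otherwise $\lambda^{(h)}(G)$ does not exist. A $\lambda^{(h)}$-cut is an $h$-extra edge-cut of cardinality $\lambda^{(h)}(G)$. For $X\subset V(G)$, $d_G(X)$ is the number of edges between $X$ and $V(G)\setminus X$, and $\xi_h(G)=\min\{d_G(X): X\subset V(G),\ |X|=h+1,\ G[X]\text{ connected}\}$. A $\lambda^{(h)}$-graph $G$ is $\lambda^{(h)}$-optimal if $\lambda^{(h)}(G)=\xi_h(G)$. A $\lambda^{(h)}$-optimal graph $G$ is super-$\lambda^{(h)}$ if every $\lambda^{(h)}$-cut $F$ of $G$ isolates at least one connected subgraph of order $h+1$, i.e. some component of $G-F$ has exactly $h+1$ vertices. These notions apply to connected graphs only; a disconnected graph is not super-$\lambda^{(h)}$. For a super-$\lambda^{(h)}$ graph $G$, the persistence $\rho^{(h)}(G)$ is the maximum integer $m$ such that $G-F$ is still super-$\lambda^{(h)}$ for every $F\subseteq E(G)$ with $|F|\leqslant m$. *)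

(* Defs.v *)
From mathcomp Require Import all_boot.

Set Implicit Arguments.
Unset Strict Implicit.
Unset Printing Implicit Defensive.

Section Minimum.
Variables (I : finType) (P : pred I) (f : I -> nat).

(* Minimum of f over P, None when P is empty. *)
Definition minimum : option nat :=
  if [pick i | P i] is Some i0 then Some (f [arg min_(i < i0 | P i) f i])
  else None.

Lemma minimumP k :
  reflect ((exists2 i, P i & f i = k) /\ (forall i, P i -> k <= f i))
          (minimum == Some k).
Proof.
rewrite /minimum; case: pickP => [i0 Pi0 | P0]; last first.
  by constructor=> -[[i]]; rewrite P0.
case: arg_minnP => // i Pi le_i; apply: (iffP eqP) => [[<-] | [[j Pj <-] le_j]].
  by split=> //; exists i.
by congr Some; apply/eqP; rewrite eqn_leq le_i // le_j.
Qed.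

End Minimum.

Record sgraph (T : finType) := SGraph {
  edges : {set {set T}};
  edges_card2 : [forall e in edges, #|e| == 2]
}.

Section Graphs.
Variable T : finType.
Implicit Types (G : sgraph T) (F : {set {set T}}) (X C : {set T}) (h m : nat).

Definition adj G : rel T := [rel x y | [set x; y] \in edges G].

Lemma edges_inj : injective (@edges T).
Proof.
by move=> [E1 H1] [E2 H2] /= E12; case: E2 / E12 H2 => H2; congr SGraph;
   apply: bool_irrelevance.
Qed.

Lemma del_edges_card2 G F : [forall e in edges G :\: F, #|e| == 2].
Proof.
apply/forall_inP=> e; rewrite inE => /andP[_].
exact: (forall_inP (edges_card2 G)).
Qed.

Definition del_edges G F : sgraph T := SGraph (del_edges_card2 G F).

Definition degree G (x : T) : nat := #|[set y | adj G x y]|.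

(* The value 0 is only used for the graph without vertices. *)
Definition min_degree G : nat := odflt 0 (minimum predT (degree G)).

(* The graph without vertices counts as connected, so that "disconnected"
   always means having at least two components. *)
Definition connected G : bool := [forall x, forall y, connect (adj G) x y].

Definition components G : {set {set T}} :=
  equivalence_partition (connect (adj G)) [set: T].

(* Connectedness of the induced subgraph G[X]. *)
Definition connected_on G X : bool :=
  [forall x in X, forall y in X, connect [rel u v in X | adj G u v] x y].

Definition boundary_card G X : nat :=
  #|[set e in edges G | [exists x in X, exists y in ~: X, e == [set x; y]]]|.

Definition extra_edge_cut h G F : bool :=
  [&& F \subset edges G, ~~ connected (del_edges G F)
    & [forall C in components (del_edges G F), h < #|C|]].

Definition lambda h G : option nat :=
  minimum (extra_edge_cut h G) (fun F => #|F|).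

Definition lambda_cut h G F : bool :=
  extra_edge_cut h G F && (lambda h G == Some #|F|).

Definition xi h G : option nat :=
  minimum (fun X => (#|X| == h.+1) && connected_on G X) (boundary_card G).

Definition lambda_graph h G : bool := connected G && isSome (lambda h G).

Definition lambda_optimal h G : bool :=
  lambda_graph h G && (lambda h G == xi h G).

Definition super_lambda h G : bool :=
  lambda_optimal h G &&
  [forall F : {set {set T}}, lambda_cut h G F ==>
     [exists C in components (del_edges G F), #|C| == h.+1]].

Definition persists h G m : bool :=
  [forall F : {set {set T}}, (F \subset edges G) && (#|F| <= m) ==>
     super_lambda h (del_edges G F)].

(* Bounding m by the number of edges loses nothing: see [persistenceP]. *)
Definition persistence h G : nat :=
  \max_(m < #|edges G|.+1 | persists h G m) m.

Lemma super_lambda_edges h G : super_lambda h G -> edges G != set0.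
Proof.
case/andP=> /andP[/andP[cG]]; rewrite /lambda /minimum.
case: pickP => // F /and3P[_ ncF _] _ _ _; apply: contra ncF => /eqP E0.
by rewrite (_ : del_edges G F = G) //; apply: edges_inj; rewrite /= E0 set0D.
Qed.

Lemma persistenceP h G : super_lambda h G ->
  persists h G (persistence h G) /\
  forall m, persists h G m -> m <= persistence h G.
Proof.
move=> sG; have p0 : persists h G 0.
  apply/forallP=> F; apply/implyP=> /andP[_]; rewrite leqn0 cards_eq0 => /eqP->.
  by rewrite (_ : del_edges G set0 = G) //; apply: edges_inj; rewrite /= setD0.
split.
  rewrite /persistence; elim/big_ind: _ => // m n pm pn.
  by case: (leqP m n).
move=> m pm; have lt_m : m < #|edges G|.+1.
  rewrite ltnS leqNgt; apply/negP=> lt_Em.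
  have := forallP pm (edges G); rewrite subxx (ltnW lt_Em) /=.
  by move/super_lambda_edges; rewrite /= setDv eqxx.
exact: (bigmax_sup (Ordinal lt_m)).
Qed.

End Graphs.

(* Main.v *)
Require Import Defs.
From mathcomp Require Import all_boot all_algebra.

(* Deleting the edges at a vertex of minimum degree isolates it, so these
   delta(G) edges leave a disconnected graph, which is not super-lambda. *)

(** If the persistence were at least the minimum degree, deleting all edges at a vertex of minimum
    degree would leave a super-lambda, hence connected, graph. [card_incident_edges] keeps this
    deletion within the allowed size; [del_incident_edges_disconnected] gives the contradiction. *)

Definition incident_edges {T : finType} (G : sgraph T) (v : T) : {set {set T}} :=
  [set e in edges G | v \in e].

(** Each edge at [v] is the image of a neighbour [y] under [y |-> [set v; y]]. *)
Lemma card_incident_edges {T : finType} (G : sgraph T) (v : T) :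
  #|incident_edges G v| <= degree G v.
Proof.
apply: leq_trans (leq_imset_card (fun y => [set v; y]) _).
apply/subset_leq_card/subsetP=> e; rewrite inE => /andP[eG].
have /cards2P[a [b [_ def_e]]] := forall_inP (edges_card2 G) e eG.
move: eG; rewrite {e}def_e !inE => abG /orP[] /eqP->.
  by apply/imsetP; exists b; rewrite ?inE.
by apply/imsetP; exists a; [rewrite inE /adj /= setUC | rewrite setUC].
Qed.

(** A nonempty path from [v] would have to start with a deleted edge. *)
Lemma del_incident_edges_disconnected {T : finType} (G : sgraph T) (v w : T) :
  w != v -> ~~ connected (del_edges G (incident_edges G v)).
Proof.
move=> wv; apply/negP=> /forallP/(_ v)/forallP/(_ w)/connectP[[|u p] /=].
  by move=> _ ewv; rewrite ewv eqxx in wv.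
by rewrite /adj /= !inE eqxx andbT andNb.
Qed.

Lemma super_lambda_neq {T : finType} (G : sgraph T) (h : nat) (v : T) :
  super_lambda h G -> exists w, w != v.
Proof.
move/super_lambda_edges/set0Pn=> [e eG].
have /cards2P[a [b [ab _]]] := forall_inP (edges_card2 G) e eG.
by have [av|] := eqVneq a v; [exists b; rewrite -av eq_sym | exists a].
Qed.

(** The vertex [x] rules out the default value 0 of [min_degree]. *)
Lemma min_degree_attained {T : finType} (G : sgraph T) (x : T) :
  exists v, degree G v = min_degree G.
Proof.
rewrite /min_degree /minimum; case: pickP => [i _ | /(_ x) //].
by eexists.
Qed.

Theorem theorem1p6 (T : finType) (G : sgraph T) (h : nat)
    (superG : super_lambda h G) :
  ((persistence h G)%:Z <= (min_degree G)%:Z - 1)%R.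
Proof.
have /set0Pn[e eG] := super_lambda_edges superG.
have /cards2P[x _] := forall_inP (edges_card2 G) e eG.
have [v degv] := min_degree_attained G x.
have [w wv] := super_lambda_neq G h v superG.
have [persG _] := persistenceP superG.
(* The strict bound makes [min_degree G] positive, so its predecessor in [nat] agrees with the
   integer subtraction. *)
suff lt_pd : persistence h G < min_degree G.
  by rewrite -(prednK (leq_ltn_trans (leq0n _) lt_pd)) -addn1 PoszD GRing.addrK
             lez_nat -ltnS (ltn_predK lt_pd).
rewrite ltnNge; apply/negP=> le_dp.
have := forallP persG (incident_edges G v).
have -> : incident_edges G v \subset edges G.
  by apply/subsetP=> f; rewrite inE => /andP[].
rewrite (leq_trans (card_incident_edges G v)) ?degv //=.
case/andP=> /andP[/andP[conn _] _] _.
by have := del_incident_edges_disconnected G v w wv; rewrite conn.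
Qed.
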